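(* Let $(L,\mu,\delta)$ be an InvDer associative algebra over $\mathbb{K}$, and let $R:L\to L$ be an algebra endomorphism of $(L,\mu)$ (a linear map with $R(\mu(x,y))=\mu(Rx,Ry)$ for all $x,y\in L$) satisfying $R^2x=Rx$ for all $x\in L$, $\delta\circ R=R\circ\delta$ and $\delta^{-1}\circ R=R\circ\delta^{-1}$. Define $[x,y]=\mu(Rx,y)-\mu(Ry,x)$ for all $x,y\in L$. Then $(L,[\cdot,\cdot],\delta)$ is an InvDer-Lie algebra.
   Context: $\mathbb{K}$ is a field of characteristic $0$. A derivation of an algebra $(L,\mu)$ is a linear map $d:L\to L$ with $d(\mu(x,y))=\mu(dx,y)+\mu(x,dy)$ for all $x,y$. $\mathrm{InvDer}(L)$ denotes the set of invertible derivations $\delta$ of the algebra $L$ such that $\delta^{-1}$ is also a derivation. An InvDer associative algebra $(L,\mu,\delta)$ is an associative algebra $(L,\mu)$ (not assumed unital) equipped with $\delta\in\mathrm{InvDer}(L)$ satisfying $\mu(\delta x,\mu(y,z))=\mu(\mu(x,y),\delta z)$ for all $x,y,z\in L$. An InvDer-Lie algebra $(L,[\cdot,\cdot],\delta)$ is a Lie algebra $(L,[\cdot,\cdot])$ equipped with $\delta\in\mathrm{InvDer}(L)$ satisfying $[\delta x,[y,z]]+[\delta y,[z,x]]+[\delta z,[x,y]]=0$ for all $x,y,z\in L$. *)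

(* Defs.v *)
From mathcomp Require Import all_boot all_algebra.
Set Implicit Arguments.
Unset Strict Implicit.
Unset Printing Implicit Defensive.
Import GRing.Theory.
Local Open Scope ring_scope.

(* An algebra over K is an arbitrary vector space L (possibly of infinite
   dimension) with a bilinear product mu, given as an explicit function since
   L carries two products (associative and Lie) at once. *)

Definition algebra_product (K : fieldType) (L : lmodType K)
    (mu : L -> L -> L) : Prop :=
  bilinear_for *:%R *:%R mu.

Definition derivation (K : fieldType) (L : lmodType K)
    (mu : L -> L -> L) (d : L -> L) : Prop :=
  linear d /\ forall x y, d (mu x y) = mu (d x) y + mu x (d y).

Definition mutual_inverse (T : Type) (f g : T -> T) : Prop :=
  cancel f g /\ cancel g f.

Definition InvDer (K : fieldType) (L : lmodType K)
    (mu : L -> L -> L) (delta : L -> L) : Prop :=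
  derivation mu delta /\
  exists2 deltaV : L -> L, mutual_inverse delta deltaV & derivation mu deltaV.

Definition algebra_endomorphism (K : fieldType) (L : lmodType K)
    (mu : L -> L -> L) (R : L -> L) : Prop :=
  linear R /\ forall x y, R (mu x y) = mu (R x) (R y).

Record associative_algebra (K : fieldType) (L : lmodType K)
    (mu : L -> L -> L) : Prop := AssociativeAlgebra {
  assoc_bilinear : algebra_product mu;
  assoc_mulA : associative mu
}.

Record lie_algebra (K : fieldType) (L : lmodType K)
    (br : L -> L -> L) : Prop := LieAlgebra {
  lie_bilinear : algebra_product br;
  lie_alternating : forall x, br x x = 0;
  lie_jacobi : forall x y z,
    br x (br y z) + br y (br z x) + br z (br x y) = 0
}.

Record invder_associative_algebra (K : fieldType) (L : lmodType K)
    (mu : L -> L -> L) (delta : L -> L) : Prop := InvDerAssociativeAlgebra {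
  invder_assoc_algebra : associative_algebra mu;
  invder_assoc_der : InvDer mu delta;
  invder_assoc_twist : forall x y z,
    mu (delta x) (mu y z) = mu (mu x y) (delta z)
}.

Record invder_lie_algebra (K : fieldType) (L : lmodType K)
    (br : L -> L -> L) (delta : L -> L) : Prop := InvDerLieAlgebra {
  invder_lie_lie : lie_algebra br;
  invder_lie_der : InvDer br delta;
  invder_lie_jacobi : forall x y z,
    br (delta x) (br y z) + br (delta y) (br z x) + br (delta z) (br x y) = 0
}.

(* Main.v *)
Require Import Defs.
From mathcomp Require Import all_boot all_algebra.
Local Open Scope ring_scope.
Import GRing.Theory.

(** Write X, Y, Z for R x, R y, R z.  Since R is multiplicative and idempotent,
    R (mu X y) = mu X Y, so associativity turns an iterated bracket into a
    signed sum of triple products whose first two factors lie in the image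
    of R:

      [x, [y, z]] = (X Y) z - (X Z) y - (Y Z) x + (Z Y) x.

    With F x y z = (X Y) z + (Z Y) x, this is F x y z - F y z x, so the cyclic
    sum telescopes to 0; this is the Jacobi identity.  For the twisted
    identity, delta commutes with R, and the rule
    mu (delta X) (mu Y z) = mu (mu X Y) (delta z) plays the part of
    associativity: [delta x, [y, z]] is the same expression with delta applied
    to each last factor, and the cyclic sum telescopes in the same way.  Both
    identities are instances of the lemma [bracket_cyclic].

    Finally, any derivation of mu that commutes with R is a derivation of the
    bracket (lemma [derivation_bracket]).  This applies to delta, and also to
    its inverse, which commutes with R because delta does. *)

Section ProjectedCommutator.

Variables (K : fieldType) (L : lmodType K) (mu : L -> L -> L) (R : L -> L).
Hypotheses (mu_bilin : algebra_product mu) (R_endo : algebra_endomorphism mu R).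

Let linR : linear R := R_endo.1.
Let linl (z : L) : linear (mu^~ z) := mu_bilin.1 z.
Let linr (x : L) : linear (mu x) := mu_bilin.2 x.
Let linB := @zmod_morphism_linear K L L *:%R.

Let br (x y : L) := mu (R x) y - mu (R y) x.

Lemma bracket_bilinear : algebra_product br.
Proof.
have br_linr (x : L) : linear (br x).
  move=> a u v; rewrite /br (linr (R x)) linR (linl x).
  by rewrite scalerBr opprD addrACA.
have anti (x y : L) : br x y = - br y x by rewrite /br opprB.
split=> [y a u v|//]; rewrite /= !(anti _ y) (br_linr y).
by rewrite opprD scalerN.
Qed.

Lemma derivation_bracket (d : L -> L) :
  derivation mu d -> (forall x, d (R x) = R (d x)) -> derivation br d.
Proof.
case=> lind leib dR; split=> // x y.
rewrite /br (linB _ lind) !leib !dR opprD (addrC (- _)).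
exact: addrACA.
Qed.

(** Serves both the Jacobi identity, with e the identity and [twist] being
    associativity, and its twisted form, with e = delta and [twist] being the
    compatibility axiom of InvDer associative algebras. *)
Lemma bracket_cyclic (e : L -> L) (x y z : L) :
    (forall x y z, mu (e x) (mu y z) = mu (mu x y) (e z)) ->
    (forall x, e (R x) = R (e x)) -> (forall x, R (R x) = R x) ->
  br (e x) (br y z) + br (e y) (br z x) + br (e z) (br x y) = 0.
Proof.
move=> twist eR RR.
pose F a b c := mu (mu (R a) (R b)) (e c) + mu (mu (R c) (R b)) (e a).
have brF a b c : br (e a) (br b c) = F a b c - F b c a.
  rewrite /br (linB _ (linr _)) (linB _ linR) (linB _ (linl _)).
  rewrite -eR !twist !R_endo.2 !RR /F.
  by rewrite opprB opprD addrACA [RHS]addrACA [- _ + _]addrC [LHS]addrACA addrC.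
by rewrite !brF !subrKA subrr.
Qed.

End ProjectedCommutator.

Theorem proposition3p8 (K : fieldType) (charK0 : [pchar K] =i pred0)
    (L : lmodType K) (mu : L -> L -> L) (delta deltaV R : L -> L)
    (hL : invder_associative_algebra mu delta)
    (hdeltaV : mutual_inverse delta deltaV)
    (hR : algebra_endomorphism mu R)
    (hRR : forall x, R (R x) = R x)
    (hdeltaR : forall x, delta (R x) = R (delta x))
    (hdeltaVR : forall x, deltaV (R x) = R (deltaV x)) :
  invder_lie_algebra (fun x y => mu (R x) y - mu (R y) x) delta.
Proof.
case: hL => [[mu_bilin muA] [der_delta [d' [deltaK d'K] der_d']] twist].
split.
- split=> [|x|x y z]; first exact: bracket_bilinear.
  + exact: subrr.
  + exact: (bracket_cyclic _ _ _ _ mu_bilin hR id).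
- split; first exact: derivation_bracket.
  exists d' => //; apply: derivation_bracket => // x.
  by rewrite -{1}(d'K x) -hdeltaR deltaK.
- by move=> x y z; exact: (bracket_cyclic _ _ _ _ mu_bilin hR delta).
Qed.
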